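(* Consider a MIMO multiple-access system (or a point-to-point MIMO system with V-BLAST transmission) with $M$ transmit and $N$ receive antennas, $M\le N$, described by $\mathbf{y}=\mathbf{H}\mathbf{x}+\mathbf{w}$, where the entries of the $N\times M$ channel matrix $\mathbf{H}$ are i.i.d. zero-mean unit-variance circularly symmetric complex Gaussian, the transmitted vector $\mathbf{x}$ has independent entries from a finite constellation contained in $\mathbb{Z}[i]$, and the noise $\mathbf{w}$ is independent of $\mathbf{H}$ and $\mathbf{x}$ with i.i.d. zero-mean circularly symmetric complex Gaussian entries of variance $\sigma^2$; the SNR is $\rho=1/\sigma^2$. When the receiver uses naive lattice decoding, the error probability $P_e$ satisfies $$\lim_{\rho\to\infty}\frac{-\log P_e}{\log\rho}=N.$$
   Context: $\mathbb{Z}[i]$ is the ring of Gaussian integers. Naive lattice decoding outputs $\widehat{\mathbf{x}}=\arg\min_{\mathbf{z}\in\mathbb{Z}[i]^M}\|\mathbf{y}-\mathbf{H}\mathbf{z}\|$ (the closest point of the whole lattice generated by $\mathbf{H}$, ignoring the constellation boundary); a decoded point outside the constellation is counted as an error, and $P_e=\Pr\{\widehat{\mathbf{x}}\neq\mathbf{x}\}$. *)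

(* Defs.v *)
From HB Require Import structures.
From mathcomp Require Import all_boot all_order all_algebra.
From mathcomp Require Import all_classical all_reals all_analysis.
Set Implicit Arguments. Unset Strict Implicit. Unset Printing Implicit Defensive.
Import Order.TTheory GRing.Theory Num.Theory.
Local Open Scope classical_set_scope.
Local Open Scope ring_scope.

(* Gaussian integers Z[i] are represented as pairs (a, b) : int * int,
   standing for a + b i.  Complex numbers are handled through their real and
   imaginary parts. *)

Section mimo.
Context {R : realType} {N M : nat}.

Definition HzRe (Hr Hi : 'I_N -> 'I_M -> R) (z : 'I_M -> int * int) (n : 'I_N) : R :=
  \sum_(m < M) (Hr n m * (z m).1%:~R - Hi n m * (z m).2%:~R).
Definition HzIm (Hr Hi : 'I_N -> 'I_M -> R) (z : 'I_M -> int * int) (n : 'I_N) : R :=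
  \sum_(m < M) (Hr n m * (z m).2%:~R + Hi n m * (z m).1%:~R).

Definition dist2 (Hr Hi : 'I_N -> 'I_M -> R) (yr yi : 'I_N -> R)
    (z : 'I_M -> int * int) : R :=
  \sum_(n < N) ((yr n - HzRe Hr Hi z n) ^+ 2 + (yi n - HzIm Hr Hi z n) ^+ 2).

(* Naive lattice decoding errs (for transmitted x, received y) iff x is not
   the unique closest point of the whole lattice H Z[i]^M to y, i.e. some
   other lattice point z <> x is at least as close (ties, which have
   probability zero, are counted as errors). *)
Definition nld_error (Hr Hi : 'I_N -> 'I_M -> R) (yr yi : 'I_N -> R)
    (x : 'I_M -> int * int) : Prop :=
  exists z : 'I_M -> int * int, z <> x /\ dist2 Hr Hi yr yi z <= dist2 Hr Hi yr yi x.
End mimo.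

(* Mutual independence of a finite family of classes of events (each class
   being the sigma-algebra generated by one random variable): the product
   rule for every choice of one event per class.  Since every class contains
   setT, this includes the product rule for all subfamilies. *)
Definition mutual_indep {d} {T : measurableType d} {R : realType}
    (P : probability T R) (I : finType) (E : I -> set (set T)) : Prop :=
  forall A : I -> set T, (forall i, E i (A i)) ->
    P (\bigcap_(i in [set: I]) A i) = (\prod_(i : I) P (A i))%E.

Definition events_of_real {d} {T : measurableType d} {R : realType}
    (Y : T -> R) : set (set T) :=
  [set Y @^-1` B | B in [set B : set R | measurable B]].

Definition events_of_disc {T : Type} {U : Type} (Y : T -> U) : set (set T) :=
  [set Y @^-1` B | B in [set: set U]].

(* Index of the real Gaussian components:
   inl (n, m, false/true) = real/imaginary part of H_{n m},
   inr (n, false/true)    = real/imaginary part of the unit-variance noise w0_n. *)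
Definition gidx (N M : nat) : finType := (('I_N * 'I_M * bool) + ('I_N * bool))%type.

(* Error probability at SNR rho: y = H x + sigma w0 with sigma = 1/sqrt rho,
   so the noise w = sigma w0 has i.i.d. CN(0, sigma^2) entries. *)
Definition error_prob {d} {T : measurableType d} {R : realType} {N M : nat}
    (P : probability T R) (G : gidx N M -> T -> R) (X : 'I_M -> T -> int * int)
    (rho : R) : R :=
  let Hr t n m := G (inl (n, m, false)) t in
  let Hi t n m := G (inl (n, m, true)) t in
  let sigma := (Num.sqrt rho)^-1 in
  let yr t n := HzRe (Hr t) (Hi t) (X ^~ t) n + sigma * G (inr (n, false)) t in
  let yi t n := HzIm (Hr t) (Hi t) (X ^~ t) n + sigma * G (inr (n, true)) t in
  fine (P [set t | nld_error (Hr t) (Hi t) (yr t) (yi t) (X ^~ t)]).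

(* Main.v *)
(* With [e = x - z] the decoder errs iff some nonzero [e] in Z[i]^M has
   [|H e + sigma w|^2 <= |sigma w|^2], so the transmitted [x] plays no role.

   Lower bound: if one column of [H] lies in [[-sigma, 0]]^(2N) and the noise
   in [[1, 2]]^(2N), the basis vector of that column is such an [e]; this has
   probability of order [sigma^(2N) = rho^(-N)].

   Upper bound: off an event of negligible probability all Gaussians are at
   most [L = ln rho] in absolute value, so an error forces [|H e| <= s], where
   [s] is of order [sigma L].  For fixed [e] with largest coordinate [k],
   conditioning on all columns but the one of that coordinate shows
   [P (|H e| <= s) <= (8 s / k)^(2N)].  There are O(k^(2M-1)) vectors on the
   [k]-th shell, and as [M <= N] the union bound over [k <= K] costs only the
   harmonic sum, about [ln K].  A vector beyond the shell [K] is scaled back and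
   rounded to a vector [a] on the shell [K], for which [|H a| = O(L)]; the union
   bound over this single shell gives [O(L^(2N) / K)].  Taking [K] near [rho^N]
   yields [P_e <= C (ln rho)^(2N+1) rho^(-N)]. *)
Require Import Defs.
From HB Require Import structures.
From mathcomp Require Import all_boot all_order all_algebra.
From mathcomp Require Import all_classical all_reals all_analysis.
From mathcomp Require Import measurable_realfun normal_distribution zify ring lra.
Import Order.TTheory GRing.Theory Num.Theory.
Import numFieldNormedType.Exports.
Local Open Scope classical_set_scope.
Local Open Scope ring_scope.

Set Implicit Arguments. Unset Strict Implicit. Unset Printing Implicit Defensive.

(** * One-dimensional estimates for the normal law of variance 1/2 *)

Lemma lebesgue_measure_cc (R : realType) (a b : R) : a <= b ->
  lebesgue_measure (`[a, b] : set R) = (b - a)%:E.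
Proof.
move=> ab; rewrite lebesgue_measure_itv/= lte_fin.
by case: ltgtP (ab) => [//|//|->] _; rewrite subrr.
Qed.

Lemma invr_sqrt_pi_le1 (R : realType) : (Num.sqrt pi)^-1 <= 1 :> R.
Proof.
rewrite invf_le1 ?sqrtr_gt0 ?pi_gt0//.
by rewrite -[leLHS]sqrtr1 ler_wsqrtr//; have := @pi_ge2 R; lra.
Qed.

(** The parameter [c] is the inverse variance: [c = 2] is the law of each component, and [c = 1] is
    the comparison law of the tail bound. *)
Lemma normal_pdf_sqrtVE (R : realType) (c x : R) : 0 < c ->
  normal_pdf 0 (Num.sqrt c^-1) x =
  (Num.sqrt (c^-1 * pi *+ 2))^-1 * expR (- (c / 2 * x ^+ 2)).
Proof.
move=> c0; have s0 : Num.sqrt c^-1 != 0 by rewrite gt_eqF// sqrtr_gt0 invr_gt0.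
rewrite normal_pdfE// /normal_peak /normal_fun sqr_sqrtr ?invr_ge0 ?ltW//.
congr (_ * expR _); rewrite subr0 -mulr_natr; field.
by rewrite gt_eqF.
Qed.

(** On the interval the density is at least its value at [c]. *)
Lemma normal_prob_ge (R : realType) (a b c : R) : a <= b -> 0 <= c ->
  (forall x, a <= x <= b -> `|x| <= c) ->
  (((Num.sqrt pi)^-1 * expR (- c ^+ 2) * (b - a))%:E <=
   normal_prob 0 (Num.sqrt 2^-1) `[a, b])%E.
Proof.
move=> ab c0 xc; rewrite /normal_prob.
have mab := lebesgue_measure_cc ab.
rewrite EFinM -mab -integral_cst//.
apply: ge0_le_integral => //=.
- by apply/measurable_EFinP/measurable_funTS; exact: measurable_normal_pdf.
- move=> x; rewrite inE/= ?in_itv/= => xab; rewrite lee_fin normal_pdf_sqrtVE//.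
  rewrite -mulrnAr -[pi *+ 2]mulr_natl mulrA mulVf ?mul1r ?pnatr_eq0//.
  rewrite ler_wpM2l ?invr_ge0// ler_expR lerN2 divff ?mul1r ?pnatr_eq0//.
  by rewrite -[leLHS]real_normK ?num_real// ler_sqr ?nnegrE// xc.
Qed.

(** The density never exceeds [1 / sqrt pi], which is below 1. *)
Lemma normal_prob_le (R : realType) (a b : R) : a <= b ->
  (normal_prob 0 (Num.sqrt 2^-1) `[a, b] <= (b - a)%:E)%E.
Proof.
move=> ab; rewrite /normal_prob.
have mab := lebesgue_measure_cc ab.
rewrite -mab -[leRHS]mul1e -integral_cst//.
apply: ge0_le_integral => //=.
- by move=> x _; rewrite lee_fin normal_pdf_ge0.
- by apply/measurable_EFinP/measurable_funTS; exact: measurable_normal_pdf.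
- move=> x _; rewrite lee_fin normal_pdf_sqrtVE//.
  rewrite -mulrnAr -[pi *+ 2]mulr_natl mulrA mulVf ?mul1r ?pnatr_eq0//.
  rewrite mulr_ile1 ?invr_ge0 ?expR_ge0 ?invr_sqrt_pi_le1//.
  by rewrite -expR0 ler_expR oppr_le0 mulr_ge0 ?sqr_ge0.
Qed.

Lemma measurable_norm_gt (R : realType) (b : R) :
  measurable [set x : R | b < `|x|].
Proof.
rewrite (_ : mkset _ = Num.norm @^-1` `]b, +oo[).
  by rewrite -[X in measurable X]setTI; apply: normr_measurable.
by apply/seteqP; split => x /=; rewrite in_itv/= andbT.
Qed.

(** Split [exp (- x^2)] into two equal factors [exp (- x^2 / 2)]. On the tail one of them is at most
    [exp (- b^2 / 2)]; the other, divided by [sqrt pi], is [sqrt 2] times the standard normal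
    density, whose total mass is 1. *)
Lemma normal_prob_tail (R : realType) (b : R) : 0 <= b ->
  (normal_prob 0 (Num.sqrt 2^-1) [set x : R | (b < `|x|)%R] <=
   (Num.sqrt 2 * expR (- (b ^+ 2 / 2)))%:E)%E.
Proof.
move=> b0; rewrite /normal_prob.
have mT : measurable [set x : R | (b < `|x|)%R].
  rewrite (_ : mkset _ = Num.norm @^-1` `]b, +oo[).
    by rewrite -[X in measurable X]setTI; apply: normr_measurable.
  by apply/seteqP; split => x /=; rewrite in_itv/= andbT.
apply: (@le_trans _ _ (\int[lebesgue_measure]_(x in [set x : R | (b < `|x|)%R])
   ((Num.sqrt 2 * expR (- (b ^+ 2 / 2)))%:E * (normal_pdf 0 1 x)%:E)))%E.
  apply: ge0_le_integral => //=.
  - by move=> x _; rewrite lee_fin normal_pdf_ge0.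
  - by apply/measurable_EFinP/measurable_funTS; exact: measurable_normal_pdf.
  - by apply/measurable_EFinP/measurable_funTS/measurable_funM => //; exact: measurable_normal_pdf.
  - move=> x bx; rewrite -EFinM lee_fin normal_pdf_sqrtVE//.
    have := @normal_pdf_sqrtVE R 1 x ltr01.
    rewrite invr1 sqrtr1 !mul1r -(mulr_natl pi) => ->.
    rewrite -mulrnAr -[pi *+ 2]mulr_natl mulrA mulVf ?mul1r ?pnatr_eq0//.
    rewrite sqrtrM// invfM [leRHS](_ : _ = (Num.sqrt pi)^-1 *
       (expR (- (b ^+ 2 / 2)) * expR (- (2^-1 * x ^+ 2)))); last first.
      by field; rewrite !gt_eqF ?sqrtr_gt0 ?pi_gt0.
    rewrite ler_wpM2l ?invr_ge0// -expRD ler_expR divff// mul1r -subr_ge0.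
    have : b ^+ 2 <= x ^+ 2 by rewrite -[leRHS]real_normK ?num_real// ler_sqr ?nnegrE// ltW.
    lra.
rewrite ge0_integralZl//=; last 2 first.
- by apply/measurable_EFinP/measurable_funTS; exact: measurable_normal_pdf.
- by move=> x _; rewrite lee_fin normal_pdf_ge0.
rewrite -[leRHS]mule1 lee_wpmul2l//.
rewrite -(integral_normal_pdf 0 (1 : R)).
apply: ge0_subset_integral => //=.
- by apply/measurable_EFinP; exact: measurable_normal_pdf.
- by move=> x _; rewrite lee_fin normal_pdf_ge0.
Qed.

(** * Outer bounds and finite covers *)

(* A bound on the outer measure, so that covering arguments need no
   measurability of the sets being covered. *)
Definition outer_le d (T : measurableType d) (R : realType)
    (P : probability T R) (S : set T) (c : R) : Prop :=
  exists S' : set T, [/\ measurable S', S `<=` S' & (P S' <= c%:E)%E].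

Lemma outer_leW d (T : measurableType d) (R : realType) (P : probability T R)
    (S S1 : set T) (c c1 : R) :
  S `<=` S1 -> c1 <= c -> outer_le P S1 c1 -> outer_le P S c.
Proof.
move=> SS1 cc1 [S' [mS' S1S' PS']]; exists S'; split => //.
  exact: subset_trans S1S'.
by apply: le_trans PS' _; rewrite lee_fin.
Qed.

Lemma outer_leU d (T : measurableType d) (R : realType) (P : probability T R)
    (S1 S2 : set T) (c1 c2 : R) :
  outer_le P S1 c1 -> outer_le P S2 c2 -> outer_le P (S1 `|` S2) (c1 + c2).
Proof.
move=> [A1 [mA1 SA1 PA1]] [A2 [mA2 SA2 PA2]].
exists (A1 `|` A2); split; [exact: measurableU|exact: setUSS|].
by rewrite EFinD; apply: le_trans (leeD PA1 PA2); exact: measureU2.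
Qed.

Lemma outer_le_cover d (T : measurableType d) (R : realType)
    (P : probability T R) (I : finType) (Q : pred I) (S0 : set T)
    (S : I -> set T) (c : I -> R) :
  (forall t, S0 t -> exists2 i, Q i & S i t) ->
  (forall i, Q i -> outer_le P (S i) (c i)) ->
  outer_le P S0 (\sum_(i | Q i) c i).
Proof.
move=> S0S PS; rewrite -big_filter; set s := [seq i <- _ | Q i].
have sQ : all Q s by exact: filter_all.
apply: (@outer_leW _ _ _ _ _ [set t | exists2 i, i \in s & S i t]
  _ (\sum_(i <- s) c i)) => //.
  by move=> t /S0S[i Qi Sit]; exists i => //; rewrite mem_filter Qi mem_index_enum.
elim: {S0S} s sQ => [_|i s IH /= /andP[Qi sQ]].
  by exists set0; split => //; [move=> t []|rewrite big_nil measure0].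
rewrite big_cons; apply: outer_leW (outer_leU (PS _ Qi) (IH sQ)) => //.
move=> t [j]; rewrite in_cons => /orP[/eqP -> ?|? ?]; first by left.
by right; exists j.
Qed.

Lemma outer_le_fine d (T : measurableType d) (R : realType)
    (P : probability T R) (S : set T) (c : R) :
  measurable S -> outer_le P S c -> fine (P S) <= c.
Proof.
move=> mS [S' [mS' SS' PS']]; rewrite -lee_fin fineK; last exact: fin_num_measure.
by apply: le_trans PS'; apply: le_measure => //; rewrite inE.
Qed.

(** * Independence on rectangles and the small-ball estimate *)

Definition rect_indep d (T : measurableType d) (R : realType)
    (P : probability T R) (I : finType) (G : I -> {RV P >-> R}) : Prop :=
  forall A : I -> set R, (forall i, measurable (A i)) ->
    P (\bigcap_(i in [set: I]) (G i @^-1` A i)) =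
    (\prod_(i : I) P (G i @^-1` A i))%E.

Lemma measurable_preim d (T : measurableType d) (R : realType)
    (P : probability T R) (X : {RV P >-> R}) (A : set R) :
  measurable A -> measurable (X @^-1` A).
Proof. by move=> mA; rewrite -[X in measurable X]setTI; exact: measurable_funP. Qed.

Lemma rect_prob d (T : measurableType d) (R : realType)
    (P : probability T R) (I : finType) (G : I -> {RV P >-> R}) (A : I -> set R) :
  rect_indep G -> (forall i, measurable (A i)) ->
  P (\bigcap_(i in [set: I]) (G i @^-1` A i)) =
  (\prod_(i : I) fine (P (G i @^-1` A i)))%:E.
Proof.
move=> GI mA; rewrite GI// -prodEFin; apply: eq_bigr => i _.
by rewrite fineK// fin_num_measure//; exact: measurable_preim.
Qed.

Lemma measurable_cell (R : realType) (eta : R) (m : int) : 0 < eta ->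
  measurable [set x : R | Num.floor (x / eta) = m].
Proof.
move=> eta0; rewrite (_ : mkset _ = `[m%:~R * eta, (m + 1)%:~R * eta[%classic)//.
apply/seteqP; split => x /=; rewrite in_itv/= -ler_pdivlMr// -ltr_pdivrMr//.
  by move=> <-; exact: floor_itv.
by move=> /floor_def.
Qed.

(** As [h] is injective, the cells are pairwise disjoint. *)
Lemma sum_cells_le1 d (T : measurableType d) (R : realType)
    (P : probability T R) (X : {RV P >-> R}) (eta : R) (K : finType)
    (h : K -> int) : 0 < eta -> injective h ->
  \sum_(k : K) fine (P (X @^-1` [set x : R | Num.floor (x / eta) = h k])) <= 1.
Proof.
move=> eta0 hI; pose F k := X @^-1` [set x : R | Num.floor (x / eta) = h k].
have mF k : measurable (F k) by apply: measurable_preim; exact: measurable_cell.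
have tF D : trivIset D F.
  by move=> i j _ _ [t [/= ti tj]]; apply: hI; rewrite -ti -tj.
rewrite -lee_fin -sumEFin.
under eq_bigr do rewrite (fineK (fin_num_measure P _ (mF _))).
rewrite (@fsbig_seq _ _ _ _ (index_enum K) (fun k => P (F k)))//; last exact: index_enum_uniq.
rewrite -measure_fin_bigcup//.
by apply: probability_le1; apply: fin_bigcup_measurable; first exact: finite_seq.
Qed.

(* The coordinates outside [J] are frozen up to [eta] by cutting space into
   cells of side [eta]; on each cell the product rule replaces conditioning. *)
Lemma small_ball d (T : measurableType d) (R : realType)
    (P : probability T R) (I : finType) (G : I -> {RV P >-> R}) (J : pred I)
    (S : set T) (B eta u : R) (ctr : (I -> int) -> I -> R) :
  rect_indep G -> 0 < eta -> 0 <= u ->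
  (forall i a, J i -> (P (G i @^-1` `[(a - u)%R, (a + u)%R]) <= (2 * u)%:E)%E) ->
  (forall t, S t -> forall i, `|G i t| <= B) ->
  (forall t, S t -> forall i, J i ->
     `|G i t - ctr (fun j => if J j then 0 else Num.floor (G j t / eta)) i| <= u) ->
  outer_le P S ((2 * u) ^+ #|J|).
Proof.
move=> GI eta0 u0 Gu SB Sctr.
(* Every cell met by [[-B, B]] has its index between [-L] and [L]; the extra 1 absorbs the rounding
   down of [- B / eta]. *)
pose L := `|Num.floor (B / eta)|%N.+1.
pose h (k : 'I_(L + L).+1) : int := k%:Z - L%:Z.
have hI : injective h by move=> k l /addIr [] /val_inj.
pose dec (c : {ffun I -> 'I_(L + L).+1}) i : int := if J i then 0 else h (c i).
pose Box c i : set R := if J i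
  then `[(ctr (dec c) i - u)%R, (ctr (dec c) i + u)%R]%classic
  else [set x : R | Num.floor (x / eta) = h (c i)].
have mBox c i : measurable (Box c i).
  by rewrite /Box; case: (J i) => //; exact: measurable_cell.
(* Coordinates in [J] are not cut: they use the single index [ord0], of weight [2 * u]. The sum over
   all [c] then factors over the coordinates, with factor [2 * u] on [J] and at most 1 elsewhere. *)
pose F i (k : 'I_(L + L).+1) : R := if J i then (if k == ord0 then 2 * u else 0)
  else fine (P (G i @^-1` [set x : R | Num.floor (x / eta) = h k])).
have F0 i k : 0 <= F i k.
  by rewrite /F; case: (J i); [case: ifP => // _; rewrite mulr_ge0|rewrite fine_ge0].
pose Q (c : {ffun I -> 'I_(L + L).+1}) := [forall i, J i ==> (c i == ord0)].
apply: (@outer_leW _ _ _ _ _ S _ (\sum_(c | Q c) \prod_i F i (c i))) => //.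
  apply: (@le_trans _ _ (\sum_(c : {ffun I -> 'I_(L + L).+1}) \prod_i F i (c i))).
    rewrite [leRHS](bigID Q)/= lerDl; apply: sumr_ge0 => c _.
    by apply: prodr_ge0 => i _.
  rewrite -bigA_distr_bigA/= -prodr_const [leRHS]big_mkcond/=.
  apply: ler_prod => i _; rewrite sumr_ge0//=; rewrite /F unfold_in.
  case: (J i); last exact: sum_cells_le1.
  by rewrite -big_mkcond/= big_pred1_eq.
apply: (@outer_le_cover _ _ _ _ _ _ _
  (fun c => \bigcap_(i in [set: I]) (G i @^-1` Box c i))).
  move=> t St.
  have hk i : {k : 'I_(L + L).+1 | Num.floor (G i t / eta) = h k}.
    have /ler_normlP[B1 B2] := SB t St i.
    have u1 : Num.floor (G i t / eta) <= Num.floor (B / eta).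
      by apply: le_floor; rewrite ler_pM2r ?invr_gt0.
    have l1 : - Num.floor (B / eta) - 1 <= Num.floor (G i t / eta).
      rewrite floor_ge_int.
      have := floor_itv (B / eta); rewrite !intrD => /andP[_ H].
      have : - (B / eta) <= G i t / eta by rewrite -mulNr ler_pM2r ?invr_gt0// lerNl.
      rewrite !rmorphN/=; lra.
    have n0 : (0 <= Num.floor (G i t / eta) + L%:Z) by rewrite /L; lia.
    have nL : (absz (Num.floor (G i t / eta) + L%:Z)%R < (L + L).+1)%N by rewrite /L; lia.
    by exists (Ordinal nL); rewrite /h/=; lia.
  pose c := [ffun i => if J i then ord0 else sval (hk i)].
  have decE : dec c = fun j => if J j then 0 else Num.floor (G j t / eta).
    apply/funext => j; rewrite /dec/c ffunE; case: (J j) => //.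
    by rewrite -(svalP (hk j)).
  exists c; first by apply/forallP => i; apply/implyP => Ji; rewrite ffunE Ji.
  move=> i _; rewrite /Box/=; case: ifPn => Ji.
    rewrite decE/= in_itv/= -ler_distl; exact: Sctr.
  by rewrite /= ffunE (negbTE Ji); exact: (svalP (hk i)).
move=> c /forallP Qc.
exists (\bigcap_(i in [set: I]) (G i @^-1` Box c i)); split => //.
  apply: fin_bigcap_measurable; first exact: finite_finset.
  by move=> i _; exact: measurable_preim.
rewrite rect_prob// lee_fin; apply: ler_prod => i _; rewrite fine_ge0//=.
rewrite /Box /F; case: ifPn => Ji //.
have /implyP/(_ Ji)/eqP -> := Qc i; rewrite eqxx.
rewrite -lee_fin fineK; first exact: Gu.
by rewrite fin_num_measure//; exact: measurable_preim.
Qed.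

(** * Gaussian integer vectors and their images under the channel *)

(** Views Z[i]^M as Z^(2M), so that the size of a vector is its sup norm over 2M integers. *)
Definition gcoord M (e : 'I_M -> int * int) (x : 'I_M * bool) : int :=
  if x.2 then (e x.1).2 else (e x.1).1.

Definition chan (R : realType) N M (g : gidx N M -> R) (b : bool) n m : R :=
  g (inl (n, m, b)).

(** A sup norm over the real components, so that each row of the channel is constrained
    separately. *)
Definition small_image (R : realType) N M (g : gidx N M -> R)
    (e : 'I_M -> int * int) (s : R) : Prop :=
  forall n, `|HzRe (chan g false) (chan g true) e n| <= s /\
            `|HzIm (chan g false) (chan g true) e n| <= s.

(** The channel acts linearly. The factor [c] on the left keeps all coefficients integral when a
    vector is obtained by a rounded division. *)
Lemma Hz_lincomb (R : realType) N M (Hr Hi : 'I_N -> 'I_M -> R)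
    (u v w : 'I_M -> int * int) (a b c : int) n :
  (forall x, c * gcoord w x = a * gcoord u x + b * gcoord v x) ->
  c%:~R * HzRe Hr Hi w n = a%:~R * HzRe Hr Hi u n + b%:~R * HzRe Hr Hi v n /\
  c%:~R * HzIm Hr Hi w n = a%:~R * HzIm Hr Hi u n + b%:~R * HzIm Hr Hi v n.
Proof.
move=> wuv; have w1 m := congr1 (intr : int -> R) (wuv (m, false)).
have w2 m := congr1 (intr : int -> R) (wuv (m, true)).
rewrite /gcoord/= in w1 w2.
rewrite /HzRe /HzIm !mulr_sumr -!big_split/=.
split; apply: eq_bigr => m _; move: (w1 m) (w2 m); rewrite !intrD !intrM => w1m w2m.
  rewrite mulrBr !(mulrCA c%:~R) w1m w2m; ring.
rewrite mulrDr !(mulrCA c%:~R) w1m w2m; ring.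
Qed.

(** Lets bounds on [HzRe] carry over to [HzIm]. *)
Lemma HzE (R : realType) N M (Hr Hi : 'I_N -> 'I_M -> R)
    (z : 'I_M -> int * int) n :
  HzIm Hr Hi z n = HzRe Hr (fun n m => - Hi n m) (fun m => ((z m).2, (z m).1)) n.
Proof. by rewrite /HzRe /HzIm; apply: eq_bigr => m _ /=; rewrite mulNr opprK. Qed.

Lemma HzRe_bound (R : realType) N M (Hr Hi : 'I_N -> 'I_M -> R)
    (z : 'I_M -> int * int) n (Q : pred 'I_M) (B k : R) : 0 <= B -> 0 <= k ->
  (forall m, Q m -> `|Hr n m| <= B /\ `|Hi n m| <= B) ->
  (forall m, `|(z m).1%:~R : R| <= k /\ `|(z m).2%:~R : R| <= k) ->
  `|\sum_(m < M | Q m) (Hr n m * (z m).1%:~R - Hi n m * (z m).2%:~R)|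
    <= 2 * M%:R * B * k.
Proof.
move=> B0 k0 HB zk; apply: le_trans (ler_norm_sum _ _ _) _.
apply: (@le_trans _ _ (\sum_(m < M | Q m) 2 * B * k)).
  apply: ler_sum => m Qm; have [Br Bi] := HB m Qm; have [z1 z2] := zk m.
  rewrite (_ : 2 * B * k = B * k + B * k); last by ring.
  by apply: le_trans (ler_normB _ _) _; rewrite !normrM lerD// ler_pM.
rewrite sumr_const -[leLHS]mulr_natr.
rewrite (_ : 2 * M%:R * B * k = 2 * B * k * M%:R); last by ring.
apply: ler_wpM2l; first by rewrite !mulr_ge0.
by rewrite ler_nat -[leqRHS]card_ord max_card.
Qed.

(** The hypotheses say that [(x + i y) (a + i b)] is within [v] of [p + i q] in each component.
    Multiplying by the conjugate of [a + i b] turns this error into at most [2 * k * v], and the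
    division by the squared modulus gains [k^2]. *)
Lemma rotation_solve (R : realType) (a b k v p q x y : R) : 0 < k -> 0 <= v ->
  `|a| <= k -> `|b| <= k -> k ^+ 2 <= a ^+ 2 + b ^+ 2 ->
  `|x * a - y * b - p| <= v -> `|x * b + y * a - q| <= v ->
  `|x - (a * p + b * q) / (a ^+ 2 + b ^+ 2)| <= 2 * v / k /\
  `|y - (a * q - b * p) / (a ^+ 2 + b ^+ 2)| <= 2 * v / k.
Proof.
move=> k0 v0 ak bk kab xv yv.
have c0 : 0 < a ^+ 2 + b ^+ 2 by apply: lt_le_trans kab; rewrite exprn_gt0.
have main (r s : R) : `|r| <= v -> `|s| <= v -> forall a' b' : R, `|a'| <= k ->
    `|b'| <= k -> `|(a' * r + b' * s) / (a ^+ 2 + b ^+ 2)| <= 2 * v / k.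
  move=> rv sv a' b' ak' bk'; rewrite normrM normfV (gtr0_norm c0).
  rewrite ler_pdivrMr//.
  apply: (@le_trans _ _ (2 * v / k * k ^+ 2)); last first.
    by apply: ler_wpM2l => //; rewrite divr_ge0 ?mulr_ge0// ltW.
  rewrite (_ : 2 * v / k * k ^+ 2 = k * v + k * v); last by field; rewrite gt_eqF.
  by apply: le_trans (ler_normD _ _) _; rewrite !normrM lerD// ler_pM.
split.
  rewrite (_ : x - _ = (a * (x * a - y * b - p) + b * (x * b + y * a - q)) / (a ^+ 2 + b ^+ 2)).
    exact: main.
  by field; rewrite gt_eqF.
rewrite (_ : y - _ = (- b * (x * a - y * b - p) + a * (x * b + y * a - q)) / (a ^+ 2 + b ^+ 2)).
  by apply: main => //; rewrite normrN.
by field; rewrite gt_eqF.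
Qed.

Lemma card_column N M (m0 : 'I_M) :
  #|[pred i : gidx N M | if i is inl (_, m, _) then m == m0 else false]| = (N * 2)%N.
Proof.
pose f (p : 'I_N * bool) : gidx N M := inl (p.1, m0, p.2).
have fI : injective f by move=> [? ?] [? ?] [-> ->].
rewrite -[N in RHS]card_ord -card_bool -card_prod -(card_imset _ fI).
apply: eq_card => i; rewrite unfold_in; apply/idP/imsetP => [|[p _ ->]] /=.
  by case: i => [[[n m] b]|//] /= /eqP ->; exists (n, b).
by rewrite eqxx.
Qed.

(** With the other columns frozen, each entry of column [m0] times [e m0] lies within [2 * s] of a
    known point. Dividing by [e m0], of modulus at least [k], confines its real and imaginary parts
    to intervals of radius [4 * s / k]. *)
Lemma small_image_prob d (T : measurableType d) (R : realType)
    (P : probability T R) N M (G : gidx N M -> {RV P >-> R})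
    (e : 'I_M -> int * int) (k : nat) (x0 : 'I_M * bool) (B s : R) :
  rect_indep G ->
  (forall i (a u : R), 0 <= u ->
     (P (G i @^-1` `[(a - u)%R, (a + u)%R]) <= (2 * u)%:E)%E) ->
  0 < s -> (0 < k)%N ->
  (forall x, `|gcoord e x| <= k%:Z) -> `|gcoord e x0| = k%:Z ->
  outer_le P [set t | (forall i, `|G i t| <= B) /\ small_image (G ^~ t) e s]
    ((8 * s / k%:R) ^+ (N * 2)).
Proof.
move=> GI Gu s0 k0 ek ex0; case: x0 ex0 => m0 b0 ex0.
have M0 : (0 < M)%N by exact: leq_ltn_trans (ltn_ord m0).
have kR : 0 < k%:R :> R by rewrite ltr0n.
have MR : 0 < M%:R :> R by rewrite ltr0n.
pose J (i : gidx N M) := if i is inl (_, m, _) then m == m0 else false.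
(* Chosen so that freezing the other columns up to [eta] moves each component of [H e] by at most
   [s]. *)
pose eta := s / (2 * M%:R * k%:R).
have eta0 : 0 < eta by rewrite divr_gt0// !mulr_gt0.
pose a : R := (e m0).1%:~R; pose b : R := (e m0).2%:~R.
(* The channel at the lower corner of the cell [f]. Since [small_ball] passes the index 0 on [J],
   column [m0] of it vanishes, and [p + i q] below is minus the contribution of the other
   columns. *)
pose D (f : gidx N M -> int) (c : bool) (n : 'I_N) (m : 'I_M) : R :=
  eta * (f (inl (n, m, c)))%:~R.
pose ctr (f : gidx N M -> int) (i : gidx N M) : R := if i is inl (n, _, c) then
  let p := - HzRe (D f false) (D f true) e n in
  let q := - HzIm (D f false) (D f true) e n in
  (if c then a * q - b * p else a * p + b * q) / (a ^+ 2 + b ^+ 2) else 0.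
pose u := 4 * s / k%:R.
have u0 : 0 <= u by rewrite divr_ge0 ?mulr_ge0// ltW.
rewrite (_ : 8 * s / k%:R = 2 * u); last by rewrite /u; field; rewrite gt_eqF.
have ekR m : `|(e m).1%:~R : R| <= k%:R /\ `|(e m).2%:~R : R| <= k%:R.
  have := ek (m, true); have := ek (m, false); rewrite /gcoord/=.
  by rewrite -!(ler_int R) !intr_norm; split.
have kab : k%:R ^+ 2 <= a ^+ 2 + b ^+ 2.
  have : (`|gcoord e (m0, b0)|%:~R : R) = k%:R by rewrite ex0.
  rewrite intr_norm /gcoord/= => <-; rewrite real_normK ?num_real//.
  by case: (b0); rewrite -/a -/b ?lerDl ?lerDr sqr_ge0.
rewrite -(card_column N m0).
apply: (@small_ball _ _ _ _ _ G J _ B eta u ctr) => //.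
- by move=> i y _; exact: Gu.
- by move=> t [].
move=> t [GB Gs] [[[n m] c]|//] /= /eqP ->{m}.
set f := (fun j : gidx N M => _); have [Re Im] := Gs n.
have Hd n' m' c' : m' != m0 -> `|chan (G ^~ t) c' n' m' - D f c' n' m'| <= eta.
  move=> mm0; rewrite /D /f/= (negbTE mm0) /chan.
  have /andP[] := floor_itv (G (inl (n', m', c')) t / eta).
  rewrite ler_pdivlMr// ltr_pdivrMr// intrD mulrDl mul1r => h1 h2.
  by rewrite ger0_norm; lra.
have Dm0 n' c' : D f c' n' m0 = 0 by rewrite /D /f/= eqxx mulr0.
have ev : 2 * M%:R * eta * k%:R = s.
  by rewrite /eta; field; rewrite !gt_eqF.
have hre : `|chan (G ^~ t) false n m0 * a - chan (G ^~ t) true n m0 * b -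
      - HzRe (D f false) (D f true) e n| <= 2 * s.
  have := @HzRe_bound R N M (fun n m => chan (G ^~ t) false n m - D f false n m)
    (fun n m => chan (G ^~ t) true n m - D f true n m) e n
    (fun m => m != m0) eta k%:R (ltW eta0) (ltW kR).
  rewrite ev => /(_ (fun m Qm => conj (Hd n m false Qm) (Hd n m true Qm)) ekR).
  set S0 := \sum_(_ < _ | _) _.
  have -> : chan (G ^~ t) false n m0 * a - chan (G ^~ t) true n m0 * b -
    - HzRe (D f false) (D f true) e n =
    HzRe (chan (G ^~ t) false) (chan (G ^~ t) true) e n - S0.
    rewrite /HzRe (bigD1 m0)//= [in RHS](bigD1 m0)//= !Dm0 !mul0r -/a -/b.
    have -> : S0 = \sum_(m | m != m0) (chan (G ^~ t) false n m * (e m).1%:~R - chan (G ^~ t) true n m * (e m).2%:~R) -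
      \sum_(m | m != m0) (D f false n m * (e m).1%:~R - D f true n m * (e m).2%:~R).
      by rewrite -sumrB; apply: eq_bigr => m _ /=; ring.
    ring.
  by move=> S0s; apply: le_trans (ler_normB _ _) _; lra.
have him : `|chan (G ^~ t) false n m0 * b + chan (G ^~ t) true n m0 * a -
      - HzIm (D f false) (D f true) e n| <= 2 * s.
  have := @HzRe_bound R N M (fun n m => chan (G ^~ t) false n m - D f false n m)
    (fun n m => - (chan (G ^~ t) true n m - D f true n m))
    (fun m => ((e m).2, (e m).1)) n
    (fun m => m != m0) eta k%:R (ltW eta0) (ltW kR).
  rewrite ev => /(_ _ (fun m => conj (proj2 (ekR m)) (proj1 (ekR m)))).
  have : forall m, m != m0 -> `|chan (G ^~ t) false n m - D f false n m| <= eta /\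
     `|- (chan (G ^~ t) true n m - D f true n m)| <= eta.
    by move=> m mm0; rewrite normrN; split; exact: Hd.
  move=> hh /(_ hh){hh}.
  set S0 := \sum_(_ < _ | _) _.
  have -> : chan (G ^~ t) false n m0 * b + chan (G ^~ t) true n m0 * a -
    - HzIm (D f false) (D f true) e n =
    HzIm (chan (G ^~ t) false) (chan (G ^~ t) true) e n - S0.
    rewrite /HzIm (bigD1 m0)//= [in RHS](bigD1 m0)//= !Dm0 !mul0r -/a -/b.
    have -> : S0 = \sum_(m | m != m0) (chan (G ^~ t) false n m * (e m).2%:~R + chan (G ^~ t) true n m * (e m).1%:~R) -
      \sum_(m | m != m0) (D f false n m * (e m).2%:~R + D f true n m * (e m).1%:~R).
      by rewrite -sumrB; apply: eq_bigr => m _ /=; ring.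
    ring.
  by move=> S0s; apply: le_trans (ler_normB _ _) _; lra.
have s2 : 0 <= 2 * s by rewrite mulr_ge0// ltW.
have [h1 h2] := rotation_solve kR s2 (proj1 (ekR m0)) (proj2 (ekR m0)) kab hre him.
rewrite /u (_ : 4 * s = 2 * (2 * s)); last by ring.
by case: c.
Qed.

(** * Union bound over shells and reduction to finitely many shells *)

(** The extreme value is attained with a plus sign. This costs no generality, since [e] and [- e]
    have images of the same size. *)
Definition max_coord_eq M (e : 'I_M -> int * int) (k : nat) : Prop :=
  (forall x, `|gcoord e x| <= k%:Z) /\ exists x, gcoord e x = k%:Z.

Lemma card_ffun_pinned (I J : finType) (x : I) (j : J) :
  #|[pred c : {ffun I -> J} | c x == j]| = (#|J| ^ #|I|.-1)%N.
Proof.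
pose F i : {pred J} := if i == x then pred1 j else predT.
have -> : #|[pred c : {ffun I -> J} | c x == j]| = #|family F|.
  apply: eq_card => c; rewrite !inE; apply/eqP/familyP => [cx i|/(_ x)].
    by rewrite /F; case: eqP => [->|//]; rewrite inE cx.
  by rewrite /F eqxx inE => /eqP.
rewrite card_family foldrE big_map -/(index_enum I) big_enum/= (bigD1 x)//= /F eqxx card1 mul1n.
rewrite (eq_bigr (fun _ => #|J|)); last by move=> i /negbTE ->.
rewrite prod_nat_const; congr (_ ^ _)%N.
by rewrite -[in RHS](cardC1 x).
Qed.

(** A vector of the shell is encoded by the place of a coordinate equal to [k], with 2M choices, and
    by the remaining 2M - 1 coordinates, each with 2k + 1 values. *)
Lemma shell_prob d (T : measurableType d) (R : realType)
    (P : probability T R) N M (G : gidx N M -> {RV P >-> R}) (k : nat) (B s : R) :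
  rect_indep G ->
  (forall i (a u : R), 0 <= u ->
     (P (G i @^-1` `[(a - u)%R, (a + u)%R]) <= (2 * u)%:E)%E) ->
  0 < s -> (0 < k)%N ->
  outer_le P [set t | (forall i, `|G i t| <= B) /\
      exists2 e, max_coord_eq e k & small_image (G ^~ t) e s]
    ((M * 2 * (k + k).+1 ^ (M * 2).-1)%:R * (8 * s / k%:R) ^+ (N * 2)).
Proof.
move=> GI Gu s0 k0.
pose vec (c : {ffun 'I_M * bool -> 'I_(k + k).+1}) (m : 'I_M) : int * int :=
  ((c (m, false))%:Z - k%:Z, (c (m, true))%:Z - k%:Z).
have vecE c x : gcoord (vec c) x = (c x)%:Z - k%:Z by case: x => m [].
(* Coordinates are stored shifted by [k], so [ord_max] stands for the value [k]. *)
pose Q (p : ('I_M * bool) * {ffun 'I_M * bool -> 'I_(k + k).+1}) := p.2 p.1 == ord_max.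
set S0 := (S in outer_le _ S _).
apply: (@outer_leW _ _ _ _ S0 S0 _ (\sum_(p | Q p) (8 * s / k%:R) ^+ (N * 2))) => //; last first.
  apply: (@outer_le_cover _ _ _ _ _ Q _ (fun p => [set t | (forall i, `|G i t| <= B) /\
     small_image (G ^~ t) (vec p.2) s])).
    move=> t [GB [e [ek [x ex]] es]].
    have cP y : (absz (gcoord e y + k%:Z)%R < (k + k).+1)%N by have := ek y; lia.
    exists (x, [ffun y => Ordinal (cP y)]).
      by rewrite /Q/= ffunE -val_eqE/= ex; apply/eqP; lia.
    split => //; suff -> : vec [ffun y => Ordinal (cP y)] = e by [].
    apply/funext => m; rewrite /vec !ffunE/=.
    have := ek (m, false); have := ek (m, true).
    by rewrite /gcoord/=; case: (e m) => a b/= H1 H2; congr pair; lia.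
  move=> [x c]; rewrite /Q/= => /eqP cx.
  apply: (@small_image_prob _ _ _ _ _ _ _ _ _ x) => //.
    move=> y; rewrite vecE; have /= := ltn_ord (c y); case: (c y) => /= v _; lia.
  by rewrite vecE cx/=; lia.
rewrite sumr_const -[leLHS]mulr_natl ler_wpM2r//.
  by rewrite exprn_ge0// divr_ge0// mulr_ge0// ltW.
rewrite ler_nat.
rewrite -sum1_card (eq_bigl Q)//.
rewrite (partition_big fst predT)//=.
rewrite (eq_bigr (fun=> ((k + k).+1 ^ (M * 2).-1)%N)); last first.
  move=> x _; rewrite -[in RHS](card_ord (k + k).+1) -[in RHS](card_ord M) -card_bool -card_prod.
  rewrite -(card_ffun_pinned x ord_max) -sum1_card.
  rewrite (reindex_onto (fun c => (x, c)) snd)/=; last by move=> [y c]/= /andP[_ /eqP ->].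
  by apply: eq_bigl => c; rewrite /Q/= inE !eqxx !andbT.
by rewrite sum_nat_const card_prod card_bool card_ord.
Qed.

Lemma reduce_to_shells (R : realType) N M (g : gidx N M -> R) (B s : R)
    (K : nat) (e : 'I_M -> int * int) : 0 <= B -> 0 <= s -> (0 < K)%N ->
  (forall i, `|g i| <= B) -> (exists x, gcoord e x != 0) -> small_image g e s ->
  (exists2 k, (0 < k <= K)%N & exists2 e', max_coord_eq e' k & small_image g e' s) \/
  (exists2 e', max_coord_eq e' K & small_image g e' (s + 2 * M%:R * B)).
Proof.
move=> B0 s0 K0 gB [x1 ex1] es.
have [x _ xmax] := @arg_maxnP _ x1 predT (fun x => absz (gcoord e x)) isT.
set k := absz (gcoord e x) in xmax.
have k0 : (0 < k)%N by have := xmax x1 isT; lia.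
have [e' [e'k e'x] e's] : exists2 e', (forall x, `|gcoord e' x| <= k%:Z) /\ gcoord e' x = k%:Z
     & small_image g e' s.
  have [e0|e0] := leP 0 (gcoord e x).
    exists e => //; split; last by rewrite /k; lia.
    by move=> y; have := xmax y isT; lia.
  pose e' m : int * int := (- (e m).1, - (e m).2).
  have e'E y : gcoord e' y = - gcoord e y by case: y => m [].
  exists e'; first split.
  - by move=> y; rewrite e'E; have := xmax y isT; lia.
  - by rewrite e'E /k; lia.
  move=> n; have [| h1 h2] := @Hz_lincomb R N M (chan g false) (chan g true) e e e' (-1) 0 1 n.
    by move=> y; rewrite e'E; lia.
  rewrite !mul1r !mul0r !addr0 in h1 h2; rewrite h1 h2 !mulN1r !normrN.
  exact: es.
have [kK|Kk] := leqP k K.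
  by left; exists k; [rewrite k0|exists e' => //; split => //; exists x].
right.
(* Scaling by [K / k] and rounding down maps [[-k, k]] into [[-K, K]] and [k] exactly to [K], so [a]
   is on the shell [K]. From [k * a = K * e' - r] with remainders [r] below [k], the image of [a] is
   at most [(K / k) * s + 2 * M * B]. *)
pose q (z : int) := ((z * K%:Z) %/ k%:Z)%Z.
pose a m := (q (e' m).1, q (e' m).2).
pose r m := (((e' m).1 * K%:Z %% k%:Z)%Z, ((e' m).2 * K%:Z %% k%:Z)%Z).
have aE y : gcoord a y = q (gcoord e' y) by case: y => m [].
have rE y : gcoord r y = (gcoord e' y * K%:Z %% k%:Z)%Z by case: y => m [].
have kz : k%:Z != 0 by lia.
exists a; first split.
- move=> y; rewrite aE /q; have := e'k y; set z := gcoord e' y => zk.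
  have k1 : 0 < k%:Z by lia.
  have h1 : - K%:Z <= ((z * K%:Z) %/ k%:Z)%Z by rewrite lez_divRL//; nia.
  have h2 : ((z * K%:Z) %/ k%:Z)%Z < K%:Z + 1 by rewrite ltz_divLR//; nia.
  by lia.
- by exists x; rewrite aE e'x /q mulrC mulzK.
move=> n; have [| h1 h2] := @Hz_lincomb R N M (chan g false) (chan g true) e' r a K%:Z (-1) k%:Z n.
  move=> y; rewrite aE rE /q; have := divz_eq (gcoord e' y * K%:Z) k%:Z; lia.
have kR : 0 < k%:R :> R by rewrite ltr0n.
have rk m : `|(r m).1%:~R : R| <= k%:R /\ `|(r m).2%:~R : R| <= k%:R.
  rewrite -!intr_norm -[k%:R]/(k%:Z%:~R) !ler_int /r/=.
  have k1 : 0 < k%:Z by lia.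
  have := ltz_pmod ((e' m).1 * K%:Z) k1; have := modz_ge0 ((e' m).1 * K%:Z) kz.
  have := ltz_pmod ((e' m).2 * K%:Z) k1; have := modz_ge0 ((e' m).2 * K%:Z) kz.
  by lia.
have r1 : `|HzRe (chan g false) (chan g true) r n| <= 2 * M%:R * B * k%:R.
  by apply: HzRe_bound => // m _; split; exact: gB.
have r2 : `|HzIm (chan g false) (chan g true) r n| <= 2 * M%:R * B * k%:R.
  rewrite HzE; apply: HzRe_bound => //.
    by move=> m _; rewrite normrN; split; exact: gB.
  by move=> m; have [? ?] := rk m.
have fin (y a' r' : R) : k%:R * a' = K%:R * y + -1 * r' -> `|y| <= s ->
    `|r'| <= 2 * M%:R * B * k%:R -> `|a'| <= s + 2 * M%:R * B.
  move=> E ys rs; rewrite -(ler_pM2l kR) -[X in X * `|a'|](gtr0_norm kR) -normrM E.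
  apply: le_trans (ler_normD _ _) _; rewrite mulrDr mulN1r normrN normrM normr_nat.
  apply: lerD; last by rewrite mulrC.
  apply: (@le_trans _ _ (K%:R * s)); first by apply: ler_wpM2l.
  by apply: ler_wpM2r => //; rewrite ler_nat ltnW.
by have [? ?] := e's n; split; [apply: fin h1 _ _|apply: fin h2 _ _].
Qed.

(** * The error event: upper bound, measurability, lower bound *)

Definition decoding_error (R : realType) N M (sigma : R) (g : gidx N M -> R) : Prop :=
  exists2 e : 'I_M -> int * int, exists x, gcoord e x != 0 &
    \sum_(n < N) ((HzRe (chan g false) (chan g true) e n + sigma * g (inr (n, false))) ^+ 2 +
                  (HzIm (chan g false) (chan g true) e n + sigma * g (inr (n, true))) ^+ 2)
    <= \sum_(n < N) ((sigma * g (inr (n, false))) ^+ 2 + (sigma * g (inr (n, true))) ^+ 2).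

(** Each component of [H e + sigma w] is at most the norm of [sigma w], hence at most
    [2 * N * sigma * B]. Removing its noise term adds at most [sigma * B]. *)
Lemma decoding_error_small_image (R : realType) N M (sigma B : R) (g : gidx N M -> R) :
  0 <= sigma -> (forall i, `|g i| <= B) -> decoding_error sigma g ->
  exists2 e : 'I_M -> int * int, exists x, gcoord e x != 0 &
    small_image g e (3 * N%:R * sigma * B).
Proof.
move=> s0 gB [e e0 He]; exists e => // n.
have B0 : 0 <= B by exact: le_trans (gB (inr (n, true))).
have N0 : (0 < N)%N by exact: leq_ltn_trans (ltn_ord n).
have N1 : 1 <= N%:R :> R by rewrite ler1n.
have sB (i : gidx N M) : `|sigma * g i| <= sigma * B.
  by rewrite normrM ger0_norm// ler_wpM2l.
have sB2 (i : gidx N M) : (sigma * g i) ^+ 2 <= (sigma * B) ^+ 2.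
  by rewrite -[leLHS]real_normK ?num_real// ler_sqr ?nnegrE// mulr_ge0.
have S : \sum_(n < N) ((sigma * g (inr (n, false))) ^+ 2 + (sigma * g (inr (n, true))) ^+ 2)
    <= (2 * N%:R * (sigma * B)) ^+ 2.
  apply: (@le_trans _ _ (\sum_(n < N) 2 * (sigma * B) ^+ 2)).
    by apply: ler_sum => n' _; rewrite mulr2n mulrDl mul1r lerD.
  rewrite sumr_const card_ord -[leLHS]mulr_natr [leRHS]exprMn.
  rewrite mulrAC ler_wpM2r ?sqr_ge0//; nra.
have T : (HzRe (chan g false) (chan g true) e n + sigma * g (inr (n, false))) ^+ 2 +
  (HzIm (chan g false) (chan g true) e n + sigma * g (inr (n, true))) ^+ 2
    <= (2 * N%:R * (sigma * B)) ^+ 2.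
  apply: le_trans S; apply: le_trans He; rewrite [leRHS](bigD1 n)//= lerDl.
  by apply: sumr_ge0 => ? _; rewrite addr_ge0// sqr_ge0.
have fin (h w : R) : (h + w) ^+ 2 <= (2 * N%:R * (sigma * B)) ^+ 2 ->
    `|w| <= sigma * B -> `|h| <= 3 * N%:R * sigma * B.
  rewrite -[X in X <= _]real_normK ?num_real// ler_sqr ?nnegrE ?mulr_ge0// => h1 h2.
  rewrite -[h](addrK w); apply: le_trans (ler_normB _ _) _.
  have : sigma * B <= N%:R * (sigma * B) by rewrite ler_peMl// mulr_ge0.
  lra.
split; [apply: (fin _ (sigma * g (inr (n, false)))) => //|
        apply: (fin _ (sigma * g (inr (n, true)))) => //].
  by apply: le_trans T; rewrite lerDl sqr_ge0.
by apply: le_trans T; rewrite lerDr sqr_ge0.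
Qed.

(** The three terms account for a Gaussian component larger than [B], for a small image on one of
    the shells 1 to [K], and for a rounded vector on the shell [K]. *)
Lemma outer_le_decoding_error d (T : measurableType d) (R : realType)
    (P : probability T R) N M (G : gidx N M -> {RV P >-> R}) (sigma B : R)
    (K : nat) (shell := fun (k : nat) (s : R) =>
      (M * 2 * (k + k).+1 ^ (M * 2).-1)%:R * (8 * s / k%:R) ^+ (N * 2)) :
  rect_indep G ->
  (forall k A, measurable A -> P (G k @^-1` A) = normal_prob 0 (Num.sqrt 2^-1) A) ->
  (0 < N)%N -> 0 < sigma -> 0 < B -> (0 < K)%N ->
  outer_le P [set t | decoding_error sigma (G ^~ t)]
    (\sum_(i : gidx N M) Num.sqrt 2 * expR (- (B ^+ 2 / 2)) +
     (\sum_(i < K) shell i.+1 (3 * N%:R * sigma * B) +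
      shell K (3 * N%:R * sigma * B + 2 * M%:R * B))).
Proof.
move=> GI GN N0 sg0 B0 K0; set s := 3 * N%:R * sigma * B.
have s0 : 0 < s by rewrite !mulr_gt0 ?ltr0n.
have Gu i (a u : R) : 0 <= u -> (P (G i @^-1` `[(a - u)%R, (a + u)%R]) <= (2 * u)%:E)%E.
  move=> u0; rewrite GN//; apply: le_trans (normal_prob_le _) _; first by lra.
  by rewrite lee_fin; lra.
pose shellset k r := [set t | (forall i, `|G i t| <= B) /\
      exists2 e, max_coord_eq e k & small_image (G ^~ t) e r].
apply: (@outer_leW _ _ _ _ _ ([set t | exists i, B < `|G i t|] `|`
  ([set t | exists2 i : 'I_K, true & shellset i.+1 s t] `|`
   shellset K (s + 2 * M%:R * B)))) (lexx _) _.
  move=> t Et; have [GB|/existsNP[i /negP]] := pselect (forall i, `|G i t| <= B); last first.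
    by rewrite -ltNge; left; exists i.
  have [e e0 es] := decoding_error_small_image (ltW sg0) GB Et.
  have [[k /andP[k0 kK] ke]|h] := reduce_to_shells (ltW B0) (ltW s0) K0 GB e0 es; last first.
    by right; right.
  right; left; have kK' : (k.-1 < K)%N by rewrite prednK.
  by exists (Ordinal kK') => //; rewrite /= prednK.
apply: outer_leU.
  apply: (@outer_le_cover _ _ _ _ _ predT _ (fun i => [set t | B < `|G i t|])).
    by move=> t [i Bi]; exists i.
  move=> i _; have mT := measurable_norm_gt B.
  exists (G i @^-1` [set x : R | B < `|x|]); split => //.
    exact: measurable_preim.
  by rewrite GN//; apply: normal_prob_tail; exact: ltW.
apply: outer_leU.
  apply: (@outer_le_cover _ _ _ _ _ predT _ (fun i : 'I_K => shellset i.+1 s)) => //.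
  by move=> i _; exact: shell_prob.
by apply: shell_prob => //; rewrite ltr_wpDr// !mulr_ge0// ltW.
Qed.

Lemma measurable_decoding_error d (T : measurableType d) (R : realType)
    (P : probability T R) N M (G : gidx N M -> {RV P >-> R}) (sigma : R) :
  measurable [set t | decoding_error sigma (G ^~ t)].
Proof.
have mHz n (z : 'I_M -> int * int) (c : bool) : measurable_fun [set: T] (fun t =>
    if c then HzIm (chan (G ^~ t) false) (chan (G ^~ t) true) z n
    else HzRe (chan (G ^~ t) false) (chan (G ^~ t) true) z n).
  rewrite /HzIm /HzRe; case: c; apply: measurable_sum => m.
    by apply: measurable_funD; apply: measurable_funM => //; exact: measurable_funP.
  by apply: measurable_funB; apply: measurable_funM => //; exact: measurable_funP.
have mw i : measurable_fun [set: T] (fun t => sigma * G i t).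
  by apply: measurable_funM => //; exact: measurable_funP.
(* Finite functions form a countable type, which makes the event a countable union. *)
rewrite (_ : mkset _ = \bigcup_(e in [set: {ffun 'I_M -> int * int}])
  [set t | (exists x, gcoord e x != 0) /\ 0 <=
    \sum_(n < N) ((sigma * G (inr (n, false)) t) ^+ 2 + (sigma * G (inr (n, true)) t) ^+ 2) -
    \sum_(n < N) ((HzRe (chan (G ^~ t) false) (chan (G ^~ t) true) e n + sigma * G (inr (n, false)) t) ^+ 2 +
                  (HzIm (chan (G ^~ t) false) (chan (G ^~ t) true) e n + sigma * G (inr (n, true)) t) ^+ 2)]); last first.
  apply/seteqP; split => t.
    move=> [e e0 He]; exists (finfun e) => //=.
    have -> : finfun e = e :> (_ -> _) by apply/funext => m; rewrite ffunE.
    by split => //; rewrite subr_ge0.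
  by move=> [e _ [e0 He]]; exists e => //; rewrite -subr_ge0.
apply: countable_bigcupT_measurable; first exact: countableP.
move=> e; have [e0|e0] := pselect (exists x, gcoord e x != 0); last first.
  by rewrite (_ : mkset _ = set0)//; apply/seteqP; split => // t [].
set f := fun t : T => \sum_(n < N) ((sigma * G (inr (n, false)) t) ^+ 2 + (sigma * G (inr (n, true)) t) ^+ 2) -
    \sum_(n < N) ((HzRe (chan (G ^~ t) false) (chan (G ^~ t) true) e n + sigma * G (inr (n, false)) t) ^+ 2 +
                  (HzIm (chan (G ^~ t) false) (chan (G ^~ t) true) e n + sigma * G (inr (n, true)) t) ^+ 2).
rewrite (_ : mkset _ = f @^-1` `[0, +oo[); last first.
  by apply/seteqP; split => t /=; rewrite in_itv/= andbT; [case|].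
rewrite -[X in measurable X]setTI.
suff mf : measurable_fun [set: T] f by apply: mf.
apply: measurable_funB; apply: measurable_sum => n; apply: measurable_funD;
  apply: measurable_funX => //; apply: measurable_funD => //.
  exact: (mHz n e false).
exact: (mHz n e true).
Qed.

Lemma decoding_error_lower d (T : measurableType d) (R : realType)
    (P : probability T R) N M (G : gidx N M -> {RV P >-> R}) (m0 : 'I_M) :
  rect_indep G ->
  (forall k A, measurable A -> P (G k @^-1` A) = normal_prob 0 (Num.sqrt 2^-1) A) ->
  exists2 c : R, 0 < c & forall sigma, 0 < sigma <= 1 ->
    c * sigma ^+ (N * 2) <= fine (P [set t | decoding_error sigma (G ^~ t)]).
Proof.
(* The value of the density at 2, hence a lower bound for it on [[-2, 2]], which contains all the
   intervals used. Coordinates left free have probability 1, which is at least [c0]. *)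
move=> GI GN; pose c0 : R := (Num.sqrt pi)^-1 * expR (- 2 ^+ 2).
have c00 : 0 < c0 by rewrite mulr_gt0 ?expR_gt0// invr_gt0 sqrtr_gt0 pi_gt0.
exists (c0 ^+ #|gidx N M|); first exact: exprn_gt0.
move=> sigma /andP[sg0 sg1].
pose J (i : gidx N M) := if i is inl (_, m, _) then m == m0 else false.
pose A (i : gidx N M) : set R := match i with
  | inl (_, m, _) => if m == m0 then `[- sigma, 0]%classic else setT
  | inr _ => `[1, 2]%classic end.
have mA i : measurable (A i) by rewrite /A; case: i => [[[n m] b]|p] //; case: ifP.
have sub : \bigcap_(i in [set: gidx N M]) (G i @^-1` A i) `<=`
    [set t | decoding_error sigma (G ^~ t)].
  move=> t At.
  have Ah n b : - sigma <= G (inl (n, m0, b)) t <= 0.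
    by have := At (inl (n, m0, b)) I; rewrite /A/= eqxx /= in_itv/=.
  have Aw i : 1 <= G (inr i) t <= 2 by have := At (inr i) I; rewrite /A/= in_itv.
  pose e m : int * int := ((m == m0)%:Z, 0).
  exists e; first by exists (m0, false); rewrite /gcoord/= eqxx.
  have E1 n : HzRe (chan (G ^~ t) false) (chan (G ^~ t) true) e n = G (inl (n, m0, false)) t.
    rewrite /HzRe (bigD1 m0)//= big1 => [|m /negbTE mm0]; rewrite /e ?mm0/= ?eqxx /chan/=; ring.
  have E2 n : HzIm (chan (G ^~ t) false) (chan (G ^~ t) true) e n = G (inl (n, m0, true)) t.
    rewrite /HzIm (bigD1 m0)//= big1 => [|m /negbTE mm0]; rewrite /e ?mm0/= ?eqxx /chan/=; ring.
  apply: ler_sum => n _; rewrite E1 E2.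
  (* Since [sigma * w >= sigma], the sum [h + sigma * w] is nonnegative and at most [sigma * w]. *)
  have sq (h w : R) : - sigma <= h <= 0 -> 1 <= w <= 2 -> (h + sigma * w) ^+ 2 <= (sigma * w) ^+ 2.
    move=> /andP[h1 h2] /andP[w1 w2].
    have sw : sigma <= sigma * w by rewrite ler_peMr// ltW.
    rewrite ler_sqr ?nnegrE; lra.
  by apply: lerD; apply: sq.
have fP i : (if J i then c0 * sigma else c0) <= fine (P (G i @^-1` A i)).
  rewrite -lee_fin fineK; last by apply: fin_num_measure; exact: measurable_preim.
  rewrite GN//.
  have c01 : c0 <= 1.
    by rewrite mulr_ile1 ?invr_ge0 ?expR_ge0 ?invr_sqrt_pi_le1.
  rewrite /J /A; case: i => [[[n m] b]|p].
    case: ifP => _; last first.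
      by rewrite /normal_prob integral_normal_pdf lee_fin.
    apply: le_trans (@normal_prob_ge _ _ _ 2 _ _ _) => //.
    - by rewrite /c0 lee_fin; apply: ler_wpM2l; [exact: ltW|lra].
    - by rewrite oppr_le0 ltW.
    - by move=> x /andP[x1 x2]; rewrite ler_norml; apply/andP; split; lra.
  apply: le_trans (@normal_prob_ge _ _ _ 2 _ _ _) => //.
  - rewrite -/c0 lee_fin; lra.
  - lra.
  - by move=> x /andP[x1 x2]; rewrite ler_norml; apply/andP; split; lra.
apply: (@le_trans _ _ (\prod_i fine (P (G i @^-1` A i)))).
  rewrite -(card_column N m0) -prodr_const -(prodr_const J) [X in _ * X]big_mkcond -big_split/=.
  apply: ler_prod => i _; rewrite (le_trans _ (fP i)) ?andbT; rewrite unfold_in -/(J i).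
    by case: (J i); rewrite ?mulr1// mulr_ge0// ltW.
  by case: (J i); rewrite ?mulr1.
rewrite -lee_fin -rect_prob// fineK; last first.
  by apply: fin_num_measure; exact: measurable_decoding_error.
apply: le_measure; rewrite ?inE//.
  by apply: fin_bigcap_measurable => // i _; exact: measurable_preim.
exact: measurable_decoding_error.
Qed.

(** The substitution [e = x - z] is a bijection between the competitors [z] of [x] and the nonzero
    [e]; by linearity it turns the residual at [z] into [H e + sigma w]. *)
Lemma nld_error_decoding_error (R : realType) N M (sigma : R)
    (g : gidx N M -> R) (x : 'I_M -> int * int) :
  nld_error (chan g false) (chan g true)
    (fun n => HzRe (chan g false) (chan g true) x n + sigma * g (inr (n, false)))
    (fun n => HzIm (chan g false) (chan g true) x n + sigma * g (inr (n, true))) x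
  <-> decoding_error sigma g.
Proof.
pose dif (u v : 'I_M -> int * int) m := ((u m).1 - (v m).1, (u m).2 - (v m).2).
have difE u v y : gcoord (dif u v) y = gcoord u y - gcoord v y by case: y => m [].
have key z e : (forall y, gcoord e y = gcoord x y - gcoord z y) ->
  (dist2 (chan g false) (chan g true)
    (fun n => HzRe (chan g false) (chan g true) x n + sigma * g (inr (n, false)))
    (fun n => HzIm (chan g false) (chan g true) x n + sigma * g (inr (n, true))) z <=
  dist2 (chan g false) (chan g true)
    (fun n => HzRe (chan g false) (chan g true) x n + sigma * g (inr (n, false)))
    (fun n => HzIm (chan g false) (chan g true) x n + sigma * g (inr (n, true))) x) =
  (\sum_(n < N) ((HzRe (chan g false) (chan g true) e n + sigma * g (inr (n, false))) ^+ 2 +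
                  (HzIm (chan g false) (chan g true) e n + sigma * g (inr (n, true))) ^+ 2)
    <= \sum_(n < N) ((sigma * g (inr (n, false))) ^+ 2 + (sigma * g (inr (n, true))) ^+ 2)).
  move=> eE; rewrite /dist2; congr (_ <= _); apply: eq_bigr => n _.
    have [|h1 h2] := @Hz_lincomb R N M (chan g false) (chan g true) x z e 1 (-1) 1 n.
      by move=> y; rewrite eE; lia.
    rewrite !mul1r !mulN1r in h1 h2; rewrite h1 h2.
    by congr (_ ^+ 2 + _ ^+ 2); ring.
  by congr (_ ^+ 2 + _ ^+ 2); ring.
split=> [[z [zx zle]]|[e [y0 ey0] He]].
  exists (dif x z); last by rewrite -(key z)// => y; rewrite difE.
  apply: contrapT => /forallNP zx0; apply: zx; apply/funext => m.
  have := zx0 (m, false); have := zx0 (m, true); rewrite !difE /gcoord/=.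
  move=> /negP; rewrite negbK => /eqP h2 /negP; rewrite negbK => /eqP h1.
  by case: (z m) (x m) h1 h2 => [a b] [a' b'] /= h1 h2; congr pair; lia.
exists (dif x e); split.
  move=> xe; move: ey0; have := congr1 (fun z => gcoord z y0) xe.
  by rewrite difE; lia.
by rewrite (key _ e)// => y; rewrite difE; lia.
Qed.

(** * Asymptotics of the bounds *)

(** By [ln (1 - u) <= - u] at [u = 1 / (K + 2)], each new term is at most the increment of the
    logarithm. *)
Lemma harmonic_le_ln (R : realType) (K : nat) : (0 < K)%N ->
  \sum_(i < K) (i.+1%:R)^-1 <= 1 + ln K%:R :> R.
Proof.
case: K => // K _; elim: K => [|K IH]; first by rewrite big_ord1 ln1 addr0 invr1.
rewrite big_ord_recr/=.
have K2 : 0 < K.+2%:R :> R by rewrite ltr0n.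
have K1 : 0 < K.+1%:R :> R by rewrite ltr0n.
have i1 : K.+2%:R^-1 < 1 :> R by rewrite invf_lt1// ltr1n.
have := @le_ln1Dx R (- K.+2%:R^-1); rewrite ltrN2 => /(_ i1).
rewrite (_ : 1 + - _ = K.+1%:R / K.+2%:R); last first.
  by rewrite -[K.+2]addn1 natrD; field; rewrite gt_eqF// -natr1 -natrD addn1.
rewrite ln_div ?posrE// => h.
have aux (a b c s : R) : a - b <= - c -> s <= 1 + a -> s + c <= 1 + b by lra.
exact: aux h IH.
Qed.

(** Used with [D = 2M] and [n = 2N]; this is where [M <= N] matters. One has [(2k + 1)^(D - 1) * k
    <= 3^D * k^D <= 3^D * k^n], so a factor [1 / k] survives and the sum over shells is harmonic. *)
Lemma shell_le (R : realType) (D n k : nat) (r : R) : (0 < D <= n)%N ->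
  (0 < k)%N -> 0 <= r ->
  (D * (k + k).+1 ^ D.-1)%:R * (r / k%:R) ^+ n <= (D * 3 ^ D)%:R * r ^+ n / k%:R.
Proof.
move=> /andP[D0 Dn] k0 r0; have kR : 0 < k%:R :> R by rewrite ltr0n.
rewrite expr_div_n ler_pdivlMr//.
rewrite (_ : _ * _ * _ = (D * (k + k).+1 ^ D.-1 * k)%:R / k%:R ^+ n * r ^+ n); last first.
  by rewrite natrM; field; rewrite gt_eqF// exprn_gt0.
apply: ler_wpM2r; first exact: exprn_ge0.
rewrite ler_pdivrMr ?exprn_gt0// -natrX -natrM ler_nat -!mulnA leq_pmul2l//.
apply: (@leq_trans ((3 * k) ^ D)); last by rewrite expnMn leq_pmul2l ?expn_gt0// leq_pexp2l.
rewrite -[in leqRHS](prednK D0) expnSr leq_mul//; last by lia.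
by case: (D.-1) => // e; rewrite leq_exp2r//; lia.
Qed.

(** Here [L] stands for [ln rho], the truncation level is [L] as well, and [expR (- (L / 2))] is the
    noise amplitude. *)
Lemma error_bound_le (R : realType) (N M : nat) : (0 < M)%N -> (M <= N)%N ->
  exists C : R, forall L : R, (2 * N + 1)%:R <= L -> exists2 K : nat, (0 < K)%N &
    let s := 3 * N%:R * expR (- (L / 2)) * L in
    let shell := fun (k : nat) (s : R) =>
      (M * 2 * (k + k).+1 ^ (M * 2).-1)%:R * (8 * s / k%:R) ^+ (N * 2) in
    \sum_(i : gidx N M) Num.sqrt 2 * expR (- (L ^+ 2 / 2)) +
     (\sum_(i < K) shell i.+1 s + shell K (s + 2 * M%:R * L))
    <= C * L ^+ (N * 2).+1 * expR (- (N%:R * L)).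
Proof.
move=> M0 MN; set n := (N * 2)%N; set D := (M * 2)%N.
have Dn : (0 < D <= n)%N by rewrite /D /n; lia.
pose A : R := (D * 3 ^ D)%:R; have A0 : 0 <= A by rewrite ler0n.
pose b : R := 24 * N%:R; pose b' : R := 8 * (3 * N%:R + 2 * M%:R).
have b0 : 0 <= b by rewrite mulr_ge0.
have b'0 : 0 <= b' by rewrite mulr_ge0// addr_ge0// mulr_ge0.
exists (#|gidx N M|%:R * 2 + (A * b ^+ n * (N%:R + 3) + A * b' ^+ n)) => L.
rewrite natrD natrM => LN.
have N0 : 0 <= N%:R :> R by [].
have L1 : 1 <= L by lra.
have L0 : 0 < L by lra.
set E := expR (- (N%:R * L)); have E0 : 0 < E by exact: expR_gt0.
pose X := expR (N%:R * L); have X1 : 1 <= X.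
  by rewrite -[leLHS]expR0 ler_expR mulr_ge0// ltW.
(* With [X = rho^N] and [X < K <= 2 * X], the last shell gains [1 / K <= rho^(-N)], while the
   harmonic sum stays of order [L]. *)
pose K := (Num.trunc X).+1; exists K => //.
have XK : X < K%:R by exact: truncnS_gt.
have KX : K%:R <= 2 * X.
  have /andP[h _] := truncn_itv (ltW (lt_le_trans ltr01 X1)).
  by rewrite /K -natr1; lra.
have lnK : 1 + ln K%:R <= (N%:R + 3) * L.
  have : ln K%:R <= ln (2 * X) by rewrite ler_ln// posrE; lra.
  rewrite lnM ?posrE; [|lra|lra]; rewrite expRK.
  have := @ln_sublinear R 2; move=> /(_ ltac:(lra)).
  move=> h1 h2; rewrite mulrDl; lra.
set sg := expR (- (L / 2)).
have sg0 : 0 <= sg by exact: expR_ge0.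
have sg1 : sg <= 1 by rewrite -[leRHS]expR0 ler_expR; lra.
have sgn : sg ^+ n = E.
  by rewrite /sg /E -expRM_natl; congr expR; rewrite /n natrM; field.
move=> s shell.
have s0 : 0 <= s by rewrite !mulr_ge0// ltW.
have Ln : L ^+ n <= L ^+ n.+1 by apply: ler_weXn2l.
have LnS : 1 <= L ^+ n.+1 by exact: exprn_ege1.
(* As [L >= 2 * N], the tail [exp (- L^2 / 2)] is at most [exp (- N * L)]. *)
have T1 : \sum_(i : gidx N M) Num.sqrt 2 * expR (- (L ^+ 2 / 2)) <=
    #|gidx N M|%:R * 2 * L ^+ n.+1 * E.
  rewrite sumr_const -[leLHS]mulr_natl -!mulrA ler_wpM2l//.
  apply: ler_pM => //.
    rewrite -[leRHS]gtr0_norm// -sqrtr_sqr ler_wsqrtr//; lra.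
  apply: (@le_trans _ _ E); last by rewrite ler_peMl// ltW.
  rewrite ler_expR lerN2; nra.
have T2 : \sum_(i < K) shell i.+1 s <= A * b ^+ n * (N%:R + 3) * L ^+ n.+1 * E.
  apply: (@le_trans _ _ (\sum_(i < K) A * (8 * s) ^+ n * i.+1%:R^-1)).
    by apply: ler_sum => i _; apply: shell_le => //; rewrite mulr_ge0.
  rewrite -mulr_sumr.
  have -> : (8 * s) ^+ n = b ^+ n * L ^+ n * E.
    by rewrite -sgn -!exprMn; congr (_ ^+ _); rewrite /s /b -/sg; ring.
  apply: (@le_trans _ _ (A * (b ^+ n * L ^+ n * E) * ((N%:R + 3) * L))).
    apply: ler_wpM2l; first by rewrite !mulr_ge0// ?exprn_ge0// ltW.
    by apply: le_trans lnK; exact: harmonic_le_ln.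
  by rewrite exprS le_eqVlt; apply/orP; left; apply/eqP; ring.
have T3 : shell K (s + 2 * M%:R * L) <= A * b' ^+ n * L ^+ n.+1 * E.
  have s0' : 0 <= s + 2 * M%:R * L by rewrite addr_ge0// !mulr_ge0// ltW.
  apply: (@le_trans _ _ (A * (8 * (s + 2 * M%:R * L)) ^+ n / K%:R)).
    by apply: shell_le => //; rewrite mulr_ge0.
  apply: ler_pM; rewrite ?mulr_ge0 ?exprn_ge0 ?invr_ge0 ?mulr_ge0//.
    rewrite -[leRHS]mulrA ler_wpM2l//.
    apply: (@le_trans _ _ (b' ^+ n * L ^+ n)); last by rewrite ler_wpM2l// exprn_ge0.
    rewrite -exprMn lerXn2r ?nnegrE ?mulr_ge0//; first exact: ltW.
    rewrite /s /b' -/sg; have : N%:R * (sg * L) <= N%:R * L.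
      by rewrite ler_wpM2l// ler_piMl// ltW.
    lra.
  rewrite /E expRN lef_pV2 ?posrE ?expR_gt0 ?ltr0n//; exact: ltW.
apply: le_trans (lerD T1 (lerD T2 T3)) _.
by rewrite le_eqVlt; apply/orP; left; apply/eqP; ring.
Qed.

(** Constants and powers of [ln x] are eventually below [x^eps], so they do not affect the
    exponent. *)
Lemma cvg_log_rate (R : realType) (p : R -> R) (r c C : R) (q : nat) : 0 < c ->
  (\forall x \near +oo, c * expR (- (r * ln x)) <= p x <=
     C * ln x ^+ q * expR (- (r * ln x))) ->
  (- ln (p x) / ln x) @[x --> +oo] --> r.
Proof.
move=> c0 pc; apply/cvgrPdist_le => /= eps eps0.
(* From [L <= expR (a * L) / a], the power [L^q] costs at most half of [eps] in the exponent; [q.+1]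
   keeps [a] defined when [q = 0]. The other half absorbs [C * a^(-q)]. *)
pose a := eps / (2 * q.+1%:R).
have q0 : 0 < q.+1%:R :> R by rewrite ltr0n.
have a0 : 0 < a by rewrite divr_gt0// mulr_gt0.
(* The three summands secure [L >= 1], [C * a^(-q) <= eps / 2 * L] and [1 / c <= eps * L]; the last
   two are then compared with exponentials through [y <= expR y]. *)
pose L0 : R := 1 + `|2 * (C * a^-1 ^+ q) / eps| + (c * eps)^-1.
have cv : 0 < (c * eps)^-1 by rewrite invr_gt0 mulr_gt0.
near=> x.
have xL : expR L0 <= x by near: x; apply: nbhs_pinfty_ge; exact: num_real.
have : c * expR (- (r * ln x)) <= p x <= C * ln x ^+ q * expR (- (r * ln x)).
  by near: x.
have x0 : 0 < x by apply: lt_le_trans xL; exact: expR_gt0.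
have : L0 <= ln x by rewrite -[leLHS]expRK ler_ln// posrE expR_gt0.
move: (ln x) => L LL /andP[lo up].
have La : 1 <= L.
  by apply: le_trans LL; rewrite /L0 -addrA lerDl addr_ge0// ltW.
have L00 : 0 < L by lra.
have p0 : 0 < p x by apply: lt_le_trans lo; rewrite mulr_gt0// expR_gt0.
have C0 : 0 <= C.
  have := lt_le_trans p0 up; rewrite pmulr_lgt0 ?expR_gt0// pmulr_lgt0 ?exprn_gt0//.
  exact: ltW.
have expge (y : R) : y <= expR y by apply: le_trans (expR_ge1Dx y); rewrite lerDr.
have lo' : expR (- (r + eps) * L) <= p x.
  apply: le_trans lo; rewrite mulNr mulrDl opprD expRD mulrC ler_wpM2r ?expR_ge0//.
  rewrite expRN invf_ple ?posrE ?expR_gt0//; apply: le_trans (expge _).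
  rewrite -ler_pdivrMl//.
  by rewrite -invfM (mulrC eps); apply: le_trans LL; rewrite lerDr addr_ge0.
have up' : p x <= expR (- (r - eps) * L).
  apply: le_trans up _; rewrite mulNr mulrBl opprB expRD ler_wpM2r ?expR_ge0//.
  have h1 : L ^+ q <= a^-1 ^+ q * expR (eps / 2 * L).
    have h : L <= a^-1 * expR (a * L).
      by rewrite -ler_pdivrMl ?invr_gt0// invrK; exact: expge.
    have : L ^+ q <= (a^-1 * expR (a * L)) ^+ q.
      by rewrite lerXn2r// ?nnegrE ?mulr_ge0 ?expR_ge0 ?invr_ge0// ltW.
    rewrite exprMn -expRM_natl => /le_trans; apply.
    rewrite ler_wpM2l ?exprn_ge0 ?invr_ge0 ?(ltW a0)// ler_expR mulrA ler_wpM2r ?(ltW L00)//.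
    rewrite /a mulrA ler_pdivrMr ?mulr_gt0//.
    rewrite (_ : eps / 2 * _ = eps * q.+1%:R); last by field.
    by rewrite mulrC ler_wpM2l ?(ltW eps0)// ler_nat.
  have h2 : C * a^-1 ^+ q <= expR (eps / 2 * L).
    apply: le_trans (expge _).
    have : `|2 * (C * a^-1 ^+ q) / eps| <= L.
      by apply: le_trans LL; rewrite /L0 addrAC lerDr addr_ge0// ltW.
    move=> /(le_trans (ler_norm _)); rewrite ler_pdivrMr//; lra.
  apply: (@le_trans _ _ (C * (a^-1 ^+ q * expR (eps / 2 * L)))); first exact: ler_wpM2l.
  rewrite mulrA (_ : eps * L = eps / 2 * L + eps / 2 * L); last by field.
  by rewrite expRD ler_wpM2r ?expR_ge0.
have l1 : - (r + eps) * L <= ln (p x).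
  by rewrite -[leLHS]expRK ler_ln ?posrE ?expR_gt0.
have l2 : ln (p x) <= - (r - eps) * L.
  by rewrite -[leRHS]expRK ler_ln ?posrE ?expR_gt0.
have -> : r - - ln (p x) / L = (r * L + ln (p x)) / L by field; rewrite gt_eqF.
rewrite normrM normfV (gtr0_norm L00) ler_pdivrMr// ler_norml.
by apply/andP; split; lra.
Unshelve. all: by end_near. Qed.

(** * From the probabilistic model to the limit *)

(** Taking [setT] for every class of [X] turns those factors into 1. *)
Lemma mutual_indep_rect d (T : measurableType d) (R : realType)
    (P : probability T R) (I K : finType) (U : Type) (G : I -> {RV P >-> R})
    (X : K -> T -> U) :
  mutual_indep P (fun k : (I + K)%type =>
    match k with
    | inl g => events_of_real (G g)
    | inr j => events_of_disc (X j)
    end) -> rect_indep G.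
Proof.
move=> indep A mA; pose A' (k : (I + K)%type) : set T :=
  if k is inl i then G i @^-1` A i else setT.
have -> : \bigcap_(i in [set: I]) (G i @^-1` A i) = \bigcap_(k in [set: (I + K)%type]) A' k.
  apply/seteqP; split => t At; first by move=> [i|j] _; [exact: At|].
  by move=> i _; exact: (At (inl i)).
rewrite indep => [|[i|j]]; [|by exists (A i) => //; exact: mA|by exists setT].
by rewrite big_sumType/= [X in (_ * X)%E]big1 ?mule1// => j _; exact: probability_setT.
Qed.

Lemma error_probE d (T : measurableType d) (R : realType)
    (P : probability T R) N M (G : gidx N M -> {RV P >-> R})
    (X : 'I_M -> T -> int * int) (rho : R) :
  error_prob P G X rho =
  fine (P [set t | decoding_error (Num.sqrt rho)^-1 (G ^~ t)]).
Proof.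
rewrite /error_prob; congr (fine (P _)); apply/seteqP.
by split => t /=; rewrite -(nld_error_decoding_error _ (G ^~ t) (X ^~ t)).
Qed.

Lemma sqrtV_expR (R : realType) (rho : R) : 0 < rho ->
  (Num.sqrt rho)^-1 = expR (- (ln rho / 2)).
Proof.
move=> r0; rewrite expRN -{1}(lnK r0); congr _^-1.
rewrite {1}(_ : ln rho = 2%:R * (ln rho / 2)); last by field.
by rewrite expRM_natl sqrtr_sqr gtr0_norm// expR_gt0.
Qed.

Unset Implicit Arguments.

Theorem theorem3 (R : realType) (d : measure_display) (T : measurableType d)
    (P : probability T R) (N M : nat) (C : seq (int * int))
    (G : gidx N M -> {RV P >-> R}) (X : 'I_M -> T -> int * int) :
  (0 < M)%N -> (M <= N)%N ->
  (* each real Gaussian component is N(0, 1/2), so that every entry of H and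
     of w0 is a zero-mean unit-variance circularly symmetric complex Gaussian *)
  (forall k B, measurable B ->
     P (G k @^-1` B) = normal_prob 0 (Num.sqrt (2^-1)) B) ->
  (* the entries of x are Z[i]-valued random variables in the constellation C *)
  (forall j z, measurable (X j @^-1` [set z])) ->
  (forall j t, X j t \in C) ->
  (* all Gaussian components and all entries of x are mutually independent *)
  mutual_indep P (fun k : (gidx N M + 'I_M)%type =>
    match k with
    | inl g => events_of_real (G g)
    | inr j => events_of_disc (X j)
    end) ->
  (- ln (error_prob P G X rho) / ln rho) @[rho --> +oo%R] --> (N%:R : R).
Proof.
move=> M0 MN GN _ _ /mutual_indep_rect GI.
have N0 : (0 < N)%N by exact: leq_trans MN.
have [c c0 lower] := decoding_error_lower (Ordinal M0) GI GN.
have [D upper] := error_bound_le R M0 MN.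
apply: (@cvg_log_rate _ _ _ c D (N * 2).+1 c0).
near=> rho.
(* The threshold makes [ln rho] large enough for [upper], and positive, so that [sigma <= 1] as
   [lower] requires. *)
have rL : expR (2 * N + 1)%:R <= rho.
  by near: rho; apply: nbhs_pinfty_ge; exact: num_real.
have r0 : 0 < rho by apply: lt_le_trans rL; exact: expR_gt0.
have LL : (2 * N + 1)%:R <= ln rho by rewrite -[leLHS]expRK ler_ln// posrE expR_gt0.
have L0 : 0 < ln rho by apply: lt_le_trans LL; rewrite ltr0n addn1.
rewrite error_probE sqrtV_expR//; set sigma := expR (- (ln rho / 2)).
have s0 : 0 < sigma by exact: expR_gt0.
have sN : sigma ^+ (N * 2) = expR (- (N%:R * ln rho)).
  by rewrite /sigma -expRM_natl; congr expR; rewrite natrM; field.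
apply/andP; split.
  rewrite -sN; apply: lower; rewrite s0/= -[leRHS]expR0 ler_expR.
  by rewrite oppr_le0 divr_ge0// ltW.
have [K K0 bnd] := upper _ LL.
apply: le_trans bnd.
apply: outer_le_fine; first exact: measurable_decoding_error.
exact: outer_le_decoding_error.
Unshelve. all: by end_near. Qed.
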